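(* Let $1\le p<q<\infty$. Then (i) $\alpha_{T^q}(T^p)\le p/q$, and (ii) $\alpha_{S^q}(S^p)\le p/q$. In particular, $T^p$ does not coarse Lipschitz embed into $T^q$, and $S^p$ does not coarse Lipschitz embed into $S^q$.
   Context: Notation: $c_{00}$ is the space of eventually zero real sequences with unit vectors $(e_n)$, $\|x\|_0=\max_n|x_n|$; for finite $E\subset\mathbb N$, $Ex$ is the restriction of $x$ to $E$; $E<F$ means $\max E<\min F$, and $k\le E$ means $k\le \min E$. The Tsirelson space $T$ is the completion of $c_{00}$ under the unique norm with $\|x\|=\max\{\|x\|_0,\frac12\sup\sum_{j=1}^k\|E_jx\|\}$, sup over $k\in\mathbb N$ and finite sets $k\le E_1<\dots<E_k$. The Schlumprecht space $S$ is the completion of $c_{00}$ under the unique norm with $\|x\|=\max\{\|x\|_0,\sup\frac{1}{\log_2(k+1)}\sum_{j=1}^k\|E_jx\|\}$, sup over $k$ and finite sets $E_1<\dots<E_k$. For a space $X$ with $1$-unconditional basis $(e_n)$ and $p\in[1,\infty)$, the $p$-convexification $X^p$ is the space of sequences $(x_n)$ with $\sum|x_n|^pe_n\in X$, normed by $\|x\|_p=\|\sum|x_n|^pe_n\|_X^{1/p}$ (so $X^1=X$). For maps $f$ between metric spaces, $\omega_f(t)=\sup\{d(f(x),f(y)):d(x,y)\le t\}$, $\rho_f(t)=\inf\{d(f(x),f(y)):d(x,y)\ge t\}$; $f$ is a coarse embedding if $\omega_f(t)<\infty$ for all $t$ and $\rho_f(t)\to\infty$; a coarse Lipschitz embedding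 if for some $L>0$, $\omega_f(t)\le Lt+L$ and $\rho_f(t)\ge L^{-1}t-L$ for all $t\ge0$. For Banach spaces $X,Y$, the compression exponent $\alpha_Y(X)$ is the supremum of all $\alpha>0$ for which there is a coarse embedding $f:X\to Y$ and $L>0$ with $\|f(x)-f(y)\|\ge L^{-1}\|x-y\|^\alpha-L$ for all $x,y\in X$ (and $\alpha_Y(X)=0$ if no such $\alpha$ exists). *)

(* Defs.v *)
From Stdlib Require Import Reals Lra List Classical ClassicalEpsilon.
Open Scope R_scope.

(** Real sequences; index [i : nat] stands for the unit vector e_(i+1). *)
Definition seqR := nat -> R.

(** Supremum of a set of reals (0 if empty or unbounded; only used on
    nonempty bounded sets below). *)
Definition Rsup (E : R -> Prop) : R :=
  match excluded_middle_informative (bound E /\ exists x, E x) with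
  | left H => proj1_sig (completeness E (proj1 H) (proj2 H))
  | right _ => 0
  end.

Definition pw (t a : R) : R :=
  match Rlt_dec 0 t with left _ => Rpower t a | right _ => 0 end.

Definition vsub (x y : seqR) : seqR := fun n => x n - y n.

Definition restrict (E : list nat) (x : seqR) : seqR :=
  fun n => if in_dec Nat.eq_dec n E then x n else 0.

Definition proj (n : nat) (x : seqR) : seqR :=
  fun i => if Nat.ltb i n then x i else 0.

Fixpoint sumk (k : nat) (f : nat -> R) : R :=
  match k with O => 0 | S k' => sumk k' f + f k' end.

Definition supnorm (x : seqR) : R := Rsup (fun r => exists n, r = Rabs (x n)).

Definition set_lt (E F : list nat) : Prop :=
  forall a b, In a E -> In b F -> (a < b)%nat.

Definition successive (k : nat) (Es : nat -> list nat) : Prop :=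
  (1 <= k)%nat /\ (forall j, (j < k)%nat -> Es j <> nil) /\
  (forall i j, (i < j)%nat -> (j < k)%nat -> set_lt (Es i) (Es j)).

(** Tsirelson admissibility: additionally k <= min E_1 (positions counted
    from 1, i.e. index a corresponds to position a+1). *)
Definition T_admissible (k : nat) (Es : nat -> list nat) : Prop :=
  successive k Es /\ (forall a, In a (Es 0%nat) -> (k <= S a)%nat).

Definition S_admissible (k : nat) (Es : nat -> list nat) : Prop :=
  successive k Es.

Definition T_weight (k : nat) : R := / 2.
Definition S_weight (k : nat) : R := / (ln (INR k + 1) / ln 2).

(** Standard iterative construction of the implicitly defined norm:
    |x|_0 = ||x||_0,
    |x|_(m+1) = max(|x|_m, sup { w k * sum_j |E_j x|_m : admissible }). *)
Fixpoint iter_norm (adm : nat -> (nat -> list nat) -> Prop) (w : nat -> R)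
  (m : nat) (x : seqR) : R :=
  match m with
  | O => supnorm x
  | S m' => Rsup (fun r => r = iter_norm adm w m' x \/
             exists k Es, adm k Es /\
               r = w k * sumk k (fun j => iter_norm adm w m' (restrict (Es j) x)))
  end.

Definition c00_norm adm w (x : seqR) : R :=
  Rsup (fun r => exists m, r = iter_norm adm w m x).

Definition T_norm : seqR -> R := c00_norm T_admissible T_weight.
Definition S_norm : seqR -> R := c00_norm S_admissible S_weight.

(** Completion of c00 under a norm N on c00 (with respect to which (e_n)
    is a 1-unconditional basis): sequences whose basis projections are
    N-Cauchy; the norm is lim_n N(P_n x) = sup_n N(P_n x). *)
Definition in_completion (N : seqR -> R) (x : seqR) : Prop :=
  forall eps, eps > 0 -> exists n0, forall n m, (n0 <= n)%nat -> (n0 <= m)%nat ->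
    N (vsub (proj n x) (proj m x)) < eps.

Definition compl_norm (N : seqR -> R) (x : seqR) : R :=
  Rsup (fun r => exists n, r = N (proj n x)).

Definition abs_pow (p : R) (x : seqR) : seqR := fun n => pw (Rabs (x n)) p.

Definition in_conv (N : seqR -> R) (p : R) (x : seqR) : Prop :=
  in_completion N (abs_pow p x).

Definition conv_norm (N : seqR -> R) (p : R) (x : seqR) : R :=
  pw (compl_norm N (abs_pow p x)) (/ p).

Definition conv_dist (N : seqR -> R) (p : R) (x y : seqR) : R :=
  conv_norm N p (vsub x y).

Definition omega_le (inX : seqR -> Prop) (dX dY : seqR -> seqR -> R)
  (f : seqR -> seqR) (t B : R) : Prop :=
  forall x y, inX x -> inX y -> dX x y <= t -> dY (f x) (f y) <= B.

Definition rho_ge (inX : seqR -> Prop) (dX dY : seqR -> seqR -> R)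
  (f : seqR -> seqR) (t M : R) : Prop :=
  forall x y, inX x -> inX y -> dX x y >= t -> dY (f x) (f y) >= M.

Definition coarse_embedding (inX inY : seqR -> Prop) (dX dY : seqR -> seqR -> R)
  (f : seqR -> seqR) : Prop :=
  (forall x, inX x -> inY (f x)) /\
  (forall t, exists B, omega_le inX dX dY f t B) /\
  (forall M, exists t0, forall t, t >= t0 -> rho_ge inX dX dY f t M).

Definition coarse_lipschitz_embedding (inX inY : seqR -> Prop)
  (dX dY : seqR -> seqR -> R) (f : seqR -> seqR) : Prop :=
  (forall x, inX x -> inY (f x)) /\
  exists L, L > 0 /\ forall t, t >= 0 ->
    omega_le inX dX dY f t (L * t + L) /\ rho_ge inX dX dY f t (/ L * t - L).

(** The set whose supremum is the compression exponent alpha_Y(X). *)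
Definition compression_set (inX inY : seqR -> Prop) (dX dY : seqR -> seqR -> R)
  (alpha : R) : Prop :=
  alpha > 0 /\ exists f L, coarse_embedding inX inY dX dY f /\ L > 0 /\
    forall x y, inX x -> inX y -> dY (f x) (f y) >= / L * pw (dX x y) alpha - L.

(** alpha_Y(X) <= c  (the supremum, defined as 0 for the empty set, is <= c) *)
Definition compression_exponent_le (inX inY : seqR -> Prop)
  (dX dY : seqR -> seqR -> R) (c : R) : Prop :=
  is_upper_bound (compression_set inX inY dX dY) c.

(* Main.v *)
(** For a [k]-element set [l] of integers let [vec l] be the sum of its unit vectors.
    If [l] lies beyond [k] and [l'] beyond [l], then [vec l - vec l'] has norm at least
    [(w k * k)^(1/p)] in the [p]-convexification, and [w k] decays slower than any power
    of [k]. On the other hand, changing one element of [l] moves [f (vec l)] by a bounded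
    amount. The norm on c00 is boundedly complete, so iterated coordinatewise limits along
    an ultrafilter write [f (vec l)], for suitable [l] arbitrarily far out, as a fixed
    centre plus [k] bounded increments that are almost disjoint; since [q]-th powers of
    norms are subadditive on disjoint vectors, [f (vec l) - f (vec l')] has norm
    [O(k^(1/q))]. Letting [k] tend to infinity gives [alpha / p <= 1 / q]. *)

Require Import Defs.
From Stdlib Require Import Reals Lra Lia Arith List Classical ClassicalEpsilon FunctionalExtensionality.
From mathcomp Require filter.
Open Scope R_scope.

(** * Suprema, finite sums and powers *)

Lemma Rsup_ub (E : R -> Prop) (x b : R) :
  (forall y, E y -> y <= b) -> E x -> x <= Rsup E.
Proof.
  intros Hb Hx. unfold Rsup.
  destruct (excluded_middle_informative _) as [H | H].
  - destruct (completeness E (proj1 H) (proj2 H)) as [s [Hs Hs']]; simpl. now apply Hs.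
  - exfalso; apply H; split; [now exists b | now exists x].
Qed.

Lemma Rsup_le (E : R -> Prop) (x b : R) :
  E x -> (forall y, E y -> y <= b) -> Rsup E <= b.
Proof.
  intros Hx Hb. unfold Rsup.
  destruct (excluded_middle_informative _) as [H | H].
  - destruct (completeness E (proj1 H) (proj2 H)) as [s [Hs' Hs]]; simpl. now apply Hs.
  - exfalso; apply H; split; [now exists b | now exists x].
Qed.

Lemma Rsup_approx (E : R -> Prop) (x b eps : R) :
  E x -> (forall y, E y -> y <= b) -> 0 < eps -> exists y, E y /\ Rsup E - eps < y.
Proof.
  intros Hx Hb He. apply NNPP; intro H.
  assert (Rsup E <= Rsup E - eps); [| lra].
  apply Rsup_le with x; [assumption |]. intros y Hy.
  destruct (Rle_dec y (Rsup E - eps)) as [h | h]; [assumption |].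
  exfalso; apply H; exists y; split; [assumption | lra].
Qed.

Lemma sumk_le (k : nat) (f g : nat -> R) :
  (forall j, (j < k)%nat -> f j <= g j) -> sumk k f <= sumk k g.
Proof.
  induction k as [| k IH]; simpl; intros H; [lra |].
  apply Rplus_le_compat; [apply IH; intros; apply H; lia | apply H; lia].
Qed.

Lemma sumk_add (k : nat) (f g : nat -> R) :
  sumk k (fun j => f j + g j) = sumk k f + sumk k g.
Proof. induction k as [| k IH]; simpl; [lra | rewrite IH; lra]. Qed.

Lemma sumk_scal (k : nat) (c : R) (f : nat -> R) :
  sumk k (fun j => c * f j) = c * sumk k f.
Proof. induction k as [| k IH]; simpl; [lra | rewrite IH; lra]. Qed.

Lemma sumk_const (k : nat) (c : R) : sumk k (fun _ => c) = INR k * c.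
Proof. induction k as [| k IH]; [simpl; lra | rewrite S_INR; simpl; rewrite IH; lra]. Qed.

Lemma sumk_nonneg (k : nat) (f : nat -> R) :
  (forall j, (j < k)%nat -> 0 <= f j) -> 0 <= sumk k f.
Proof.
  intro H. replace 0 with (sumk k (fun _ => 0)) by (rewrite sumk_const; lra).
  now apply sumk_le.
Qed.

Lemma sumk_swap (k n : nat) (f : nat -> nat -> R) :
  sumk k (fun j => sumk n (fun i => f j i)) = sumk n (fun i => sumk k (fun j => f j i)).
Proof.
  induction k as [| k IH]; simpl.
  - rewrite sumk_const; lra.
  - rewrite IH, <- sumk_add. reflexivity.
Qed.

Lemma sumk_indicator (n a : nat) :
  sumk n (fun i => if Nat.eq_dec i a then 1 else 0) <= 1.
Proof.
  enough (H : sumk n (fun i => if Nat.eq_dec i a then 1 else 0)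
              <= if le_dec n a then 0 else 1)
    by (destruct (le_dec n a); lra).
  induction n as [| n IH]; simpl; [destruct (le_dec 0 a); lra |].
  destruct (le_dec n a), (le_dec (S n) a), (Nat.eq_dec n a); try lia; lra.
Qed.

Lemma pw_pos (t a : R) : 0 < t -> pw t a = Rpower t a.
Proof. intro H. unfold pw. destruct (Rlt_dec 0 t); [reflexivity | lra]. Qed.

Lemma pw_0 (a : R) : pw 0 a = 0.
Proof. unfold pw. destruct (Rlt_dec 0 0); [lra | reflexivity]. Qed.

Lemma pw_1 (a : R) : pw 1 a = 1.
Proof. rewrite pw_pos by lra. unfold Rpower. rewrite ln_1, Rmult_0_r. apply exp_0. Qed.

Lemma pw_nonneg (t a : R) : 0 <= pw t a.
Proof. unfold pw. destruct (Rlt_dec 0 t); [left; apply exp_pos | lra]. Qed.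

Lemma pw_gt0 (t a : R) : 0 < t -> 0 < pw t a.
Proof. intro H. rewrite pw_pos by assumption. apply exp_pos. Qed.

Lemma pw_le (s t a : R) : 0 < a -> 0 <= s -> s <= t -> pw s a <= pw t a.
Proof.
  intros Ha [Hs | Hs] Hst.
  - rewrite !pw_pos by lra. apply Rle_Rpower_l; lra.
  - subst. rewrite pw_0. apply pw_nonneg.
Qed.

Lemma pw_mult (s t a : R) : 0 <= s -> 0 <= t -> pw (s * t) a = pw s a * pw t a.
Proof.
  intros [Hs | <-] [Ht | <-]; rewrite ?Rmult_0_l, ?Rmult_0_r, ?pw_0; try lra.
  assert (0 < s * t) by nra.
  rewrite !pw_pos by lra. rewrite <- Rpower_mult_distr by assumption. reflexivity.
Qed.

Lemma pw_pw (t a b : R) : 0 <= t -> pw (pw t a) b = pw t (a * b).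
Proof.
  intros [Ht | <-]; [| now rewrite !pw_0].
  rewrite (pw_pos t) by assumption. rewrite pw_pos by apply exp_pos.
  rewrite pw_pos by assumption. apply Rpower_mult.
Qed.

Lemma pw_exp1 (t : R) : 0 <= t -> pw t 1 = t.
Proof. intros [Ht | <-]; [rewrite pw_pos; [apply Rpower_1 |]; lra | apply pw_0]. Qed.

Lemma pw_inv_r (t a : R) : 0 < a -> 0 <= t -> pw (pw t (/ a)) a = t.
Proof.
  intros Ha Ht. rewrite pw_pw by assumption.
  rewrite Rinv_l by lra. now apply pw_exp1.
Qed.

(* Either [b] is at most [eta |a|], or [a] is at most [|b| / eta]. *)
Lemma pw_add_le (q delta : R) : 0 < q -> 0 < delta ->
  exists C, 0 <= C /\ forall a b,
    pw (Rabs (a + b)) q <= (1 + delta) * pw (Rabs a) q + C * pw (Rabs b) q.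
Proof.
  intros Hq Hd.
  set (eta := pw (1 + delta) (/ q) - 1).
  assert (Hq' : 0 < / q) by now apply Rinv_0_lt_compat.
  assert (He : 0 < eta).
  { unfold eta. rewrite pw_pos by lra.
    assert (Rpower (1 + delta) 0 < Rpower (1 + delta) (/ q)) by (apply Rpower_lt; lra).
    rewrite Rpower_O in H by lra. lra. }
  assert (Heq : pw (1 + eta) q = 1 + delta).
  { unfold eta. replace (1 + (pw (1 + delta) (/ q) - 1)) with (pw (1 + delta) (/ q)) by ring.
    apply pw_inv_r; lra. }
  assert (Hi : 0 < / eta) by now apply Rinv_0_lt_compat.
  exists (pw (1 + / eta) q). split; [apply pw_nonneg |]. intros a b.
  assert (Ht := Rabs_triang a b). assert (H0 := Rabs_pos (a + b)).
  assert (Ha := Rabs_pos a). assert (Hb := Rabs_pos b).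
  assert (Pa := pw_nonneg (Rabs a) q). assert (Pb := pw_nonneg (Rabs b) q).
  destruct (Rle_dec (Rabs b) (eta * Rabs a)) as [h | h].
  - assert (pw (Rabs (a + b)) q <= pw ((1 + eta) * Rabs a) q) by (apply pw_le; lra).
    rewrite pw_mult, Heq in H by lra.
    assert (P := pw_nonneg (1 + / eta) q). nra.
  - assert (Rabs a <= / eta * Rabs b).
    { apply Rmult_le_reg_l with eta; [assumption |].
      rewrite <- Rmult_assoc, Rinv_r by lra. lra. }
    assert (pw (Rabs (a + b)) q <= pw ((1 + / eta) * Rabs b) q) by (apply pw_le; lra).
    rewrite pw_mult in H1 by lra. nra.
Qed.

Lemma ln_le (x y : R) : 0 < x -> x <= y -> ln x <= ln y.
Proof. intros Hx [H | ->]; [left; now apply ln_increasing | lra]. Qed.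

Lemma power_growth (A D s r : R) : 0 < A -> 0 <= D -> 0 < r < s ->
  exists k, (1 <= k)%nat /\ D * Rpower (INR k) r < A * Rpower (INR k) s.
Proof.
  intros HA HD Hrs.
  set (y := Rpower (D / A + 1) (/ (s - r))).
  destruct (INR_unbounded y) as [k Hk].
  assert (HDA : 0 <= D / A) by (apply Rmult_le_pos; [lra | left; apply Rinv_0_lt_compat; lra]).
  assert (Hy : 0 < y) by apply exp_pos.
  assert (Hk0 : 0 < INR k) by lra.
  exists k. split; [apply INR_lt; simpl; lra |].
  assert (E : Rpower y (s - r) = D / A + 1).
  { unfold y. rewrite Rpower_mult, Rinv_l by lra. apply Rpower_1. lra. }
  assert (L : Rpower y (s - r) <= Rpower (INR k) (s - r)) by (apply Rle_Rpower_l; lra).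
  replace s with (r + (s - r)) by ring. rewrite Rpower_plus.
  assert (P : 0 < Rpower (INR k) r) by apply exp_pos.
  assert (D < A * Rpower (INR k) (s - r)); [| nra].
  assert (A * (D / A + 1) = D + A) by (field; lra). nra.
Qed.

(** * Ultrafilter limits *)

Record free_ultrafilter (U : (nat -> Prop) -> Prop) : Prop := {
  uf_and : forall A B, U A -> U B -> U (fun n => A n /\ B n);
  uf_sub : forall A B : nat -> Prop, (forall n, A n -> B n) -> U A -> U B;
  uf_em : forall A : nat -> Prop, U A \/ U (fun n => ~ A n);
  uf_ex : forall A, U A -> exists n, A n;
  uf_cof : forall n, U (fun m => (n <= m)%nat) }.

Lemma free_ultrafilter_exists : exists U, free_ultrafilter U.
Proof.
  destruct (filter.ultraFilterLemma filter.eventually_filter) as [U [HU HE]].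
  destruct (filter.ultra_proper (UltraFilter := HU)) as [Hne [Ht Hi Hs]].
  exists U. split.
  - intros A B HA HB. exact (Hi A B HA HB).
  - intros A B HAB. apply Hs. exact HAB.
  - intros A. exact (filter.in_ultra_setVsetC A HU).
  - intros A HA. apply NNPP. intro H. apply Hne.
    apply (Hs A); [| exact HA]. intros n Hn. apply H. now exists n.
  - intro n. apply HE. exists n; [exact I |].
    intros m Hm. now apply (ssrbool.elimT ssrnat.leP).
Qed.

Section UltraLimit.

Variable U : (nat -> Prop) -> Prop.
Hypothesis HU : free_ultrafilter U.

Lemma ultra_limit (a : nat -> R) (M : R) : (forall n, Rabs (a n) <= M) ->
  exists l, forall eps, 0 < eps -> U (fun n => Rabs (a n - l) < eps).
Proof.
  intro HM.
  set (E := fun t => U (fun n => t <= a n)).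
  assert (Hb : bound E).
  { exists M. intros t Ht. destruct (uf_ex U HU _ Ht) as [n Hn].
    assert (H := HM n). unfold Rabs in H; destruct (Rcase_abs (a n)); lra. }
  assert (Hne : exists t, E t).
  { exists (- M). unfold E. apply (uf_sub U HU) with (2 := uf_cof U HU 0).
    intros n _. assert (H := HM n). unfold Rabs in H; destruct (Rcase_abs (a n)); lra. }
  destruct (completeness E Hb Hne) as [l [Hl1 Hl2]].
  exists l. intros eps He.
  assert (H1 : U (fun n => ~ l + eps / 2 <= a n)).
  { destruct (uf_em U HU (fun n => l + eps / 2 <= a n)) as [h | h]; [| assumption].
    specialize (Hl1 _ h). lra. }
  assert (H2 : exists t, E t /\ l - eps < t).
  { apply NNPP. intro H. assert (l <= l - eps); [| lra].
    apply Hl2. intros t Ht. apply Rnot_lt_le. intro. apply H. now exists t. }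
  destruct H2 as [t [Ht Hlt]].
  apply (uf_sub U HU) with (2 := uf_and U HU _ _ H1 Ht).
  intros n [h1 h2]. apply Rabs_def1; lra.
Qed.

Lemma uf_forall_lt (P : nat -> nat -> Prop) (k : nat) :
  (forall i, (i < k)%nat -> U (P i)) -> U (fun n => forall i, (i < k)%nat -> P i n).
Proof.
  induction k as [| k IH]; intro H.
  - apply (uf_sub U HU) with (2 := uf_cof U HU 0). intros; lia.
  - assert (H1 := IH (fun i Hi => H i (Nat.lt_lt_succ_r _ _ Hi))).
    apply (uf_sub U HU) with (2 := uf_and U HU _ _ H1 (H k (Nat.lt_succ_diag_r k))).
    intros n [h1 h2] i Hi. destruct (Nat.eq_dec i k) as [-> | ]; [assumption |].
    apply h1; lia.
Qed.

End UltraLimit.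

(** * Norms defined by an admissible family of successive sets *)

Definition supp (n : nat) (x : seqR) : Prop := forall i, (n <= i)%nat -> x i = 0.

Definition l1 (n : nat) (x : seqR) : R := sumk n (fun i => Rabs (x i)).

Definition vadd (x y : seqR) : seqR := fun i => x i + y i.

Definition tail (n : nat) (x : seqR) : seqR := fun i => if Nat.ltb i n then 0 else x i.

Lemma restrict_abs_le (E : list nat) (x : seqR) (i : nat) : Rabs (restrict E x i) <= Rabs (x i).
Proof.
  unfold restrict. destruct (in_dec _ i E); [lra |]. rewrite Rabs_R0. apply Rabs_pos.
Qed.

Lemma supp_dom (n : nat) (x y : seqR) :
  supp n y -> (forall i, Rabs (x i) <= Rabs (y i)) -> supp n x.
Proof.
  intros Hy H i Hi. specialize (H i). rewrite (Hy i Hi), Rabs_R0 in H.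
  destruct (Req_dec (x i) 0) as [| h]; [assumption |]. apply Rabs_pos_lt in h. lra.
Qed.

Lemma supp_restrict (n : nat) (E : list nat) (x : seqR) : supp n x -> supp n (restrict E x).
Proof. intro H. apply supp_dom with x; [assumption |]. intro; apply restrict_abs_le. Qed.

Lemma supp_proj (n : nat) (x : seqR) : supp n (proj n x).
Proof. intros i Hi. unfold proj. destruct (Nat.ltb_spec i n); [lia | reflexivity]. Qed.

Lemma l1_nonneg (n : nat) (x : seqR) : 0 <= l1 n x.
Proof. apply sumk_nonneg. intros; apply Rabs_pos. Qed.

Lemma Rabs_le_l1 (n : nat) (x : seqR) (i : nat) : supp n x -> Rabs (x i) <= l1 n x.
Proof.
  intro H. destruct (Nat.lt_ge_cases i n) as [h | h].
  - clear H. unfold l1. induction n as [| n IH]; [lia |]. simpl.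
    destruct (Nat.eq_dec i n) as [-> | ].
    + assert (P := l1_nonneg n x). unfold l1 in P. lra.
    + assert (P := Rabs_pos (x n)). specialize (IH ltac:(lia)). lra.
  - rewrite (H i h), Rabs_R0. apply l1_nonneg.
Qed.

Lemma sumk_restrict (k : nat) (Es : nat -> list nat) (x : seqR) (i : nat) :
  (forall a b, (a < b)%nat -> (b < k)%nat -> set_lt (Es a) (Es b)) ->
  sumk k (fun j => Rabs (restrict (Es j) x i)) <= Rabs (x i).
Proof.
  induction k as [| k IH]; intro H; simpl; [apply Rabs_pos |].
  destruct (in_dec Nat.eq_dec i (Es k)) as [h | h].
  - assert (sumk k (fun j => Rabs (restrict (Es j) x i)) <= sumk k (fun _ => 0)).
    { apply sumk_le. intros j Hj. unfold restrict.
      destruct (in_dec Nat.eq_dec i (Es j)) as [h' | h']; [| rewrite Rabs_R0; lra].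
      specialize (H j k Hj (Nat.lt_succ_diag_r k) i i h' h). lia. }
    rewrite sumk_const in H0. assert (P := restrict_abs_le (Es k) x i). lra.
  - assert (restrict (Es k) x i = 0) as ->.
    { unfold restrict. destruct (in_dec Nat.eq_dec i (Es k)); [contradiction | reflexivity]. }
    rewrite Rabs_R0, Rplus_0_r. apply IH. intros a b Hab Hb. apply H; lia.
Qed.

Lemma l1_blocks (n k : nat) (Es : nat -> list nat) (x : seqR) :
  successive k Es -> sumk k (fun j => l1 n (restrict (Es j) x)) <= l1 n x.
Proof.
  intros [_ [_ H]]. unfold l1. rewrite sumk_swap. apply sumk_le.
  intros i _. now apply sumk_restrict.
Qed.

Section AdmissibleNorm.

Variable adm : nat -> (nat -> list nat) -> Prop.
Variable w : nat -> R.
Hypothesis adm_successive : forall k Es, adm k Es -> successive k Es.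
Hypothesis w_range : forall k, (1 <= k)%nat -> 0 < w k <= 1.

Let iter := iter_norm adm w.
Let N := c00_norm adm w.

Lemma supnorm_bounds (n : nat) (x : seqR) : supp n x ->
  (forall i, Rabs (x i) <= supnorm x) /\
  (forall b, (forall i, Rabs (x i) <= b) -> supnorm x <= b).
Proof.
  intro H. split.
  - intro i. apply Rsup_ub with (l1 n x); [| now exists i].
    intros y [j ->]. now apply Rabs_le_l1.
  - intros b Hb. apply Rsup_le with (Rabs (x 0%nat)); [now exists 0%nat |].
    intros y [j ->]. apply Hb.
Qed.

Lemma iter_S_member_le (n m : nat) (x : seqR) :
  (forall x, supp n x -> 0 <= iter m x <= l1 n x) -> supp n x ->
  forall r, r = iter m x \/ (exists k Es, adm k Es /\
    r = w k * sumk k (fun j => iter m (restrict (Es j) x))) -> r <= l1 n x.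
Proof.
  intros H Hx r [-> | [k [Es [Ha ->]]]]; [now apply H |].
  assert (Hs := adm_successive _ _ Ha).
  assert (Hw := w_range k (proj1 Hs)).
  assert (sumk k (fun j => iter m (restrict (Es j) x)) <= l1 n x).
  { eapply Rle_trans; [| now apply (l1_blocks n k Es)].
    apply sumk_le. intros j _. apply H. now apply supp_restrict. }
  assert (0 <= sumk k (fun j => iter m (restrict (Es j) x))).
  { apply sumk_nonneg. intros j _. apply H. now apply supp_restrict. }
  nra.
Qed.

Lemma iter_bounds (m n : nat) (x : seqR) : supp n x -> 0 <= iter m x <= l1 n x.
Proof.
  revert x. induction m as [| m IH]; intros x Hx.
  - destruct (supnorm_bounds n x Hx) as [H1 H2]. unfold iter; simpl. split.
    + apply Rle_trans with (Rabs (x 0%nat)); [apply Rabs_pos | apply H1].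
    + apply H2. intro; now apply Rabs_le_l1.
  - assert (Hm := iter_S_member_le n m x IH Hx). split.
    + apply Rle_trans with (iter m x); [now apply IH |].
      apply Rsup_ub with (l1 n x); [exact Hm | now left].
    + apply Rsup_le with (iter m x); [now left | exact Hm].
Qed.

Lemma iter_S_ge (n m : nat) (x : seqR) : supp n x -> iter m x <= iter (S m) x.
Proof.
  intro Hx. apply Rsup_ub with (l1 n x); [| now left].
  apply iter_S_member_le; [intros; now apply iter_bounds | assumption].
Qed.

Lemma iter_S_block (n m k : nat) (Es : nat -> list nat) (x : seqR) : supp n x -> adm k Es ->
  w k * sumk k (fun j => iter m (restrict (Es j) x)) <= iter (S m) x.
Proof.
  intros Hx Ha. apply Rsup_ub with (l1 n x); [| right; now exists k, Es].
  apply iter_S_member_le; [intros; now apply iter_bounds | assumption].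
Qed.

Lemma iter_S_le (m : nat) (x : seqR) (b : R) : iter m x <= b ->
  (forall k Es, adm k Es -> w k * sumk k (fun j => iter m (restrict (Es j) x)) <= b) ->
  iter (S m) x <= b.
Proof.
  intros H1 H2. apply Rsup_le with (iter m x); [now left |].
  intros r [-> | [k [Es [Ha ->]]]]; auto.
Qed.

Lemma iter_mono_index (n m m' : nat) (x : seqR) : supp n x -> (m <= m')%nat ->
  iter m x <= iter m' x.
Proof.
  intros Hx H. induction H as [| m' _ IH]; [lra |].
  apply Rle_trans with (1 := IH). now apply iter_S_ge with n.
Qed.

Lemma iter_mono (m n : nat) (x y : seqR) : supp n y ->
  (forall i, Rabs (x i) <= Rabs (y i)) -> iter m x <= iter m y.
Proof.
  revert x y. induction m as [| m IH]; intros x y Hy Hxy.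
  - apply (supnorm_bounds n x (supp_dom n x y Hy Hxy)). intro i.
    apply Rle_trans with (1 := Hxy i). now apply (supnorm_bounds n y Hy).
  - apply iter_S_le.
    + apply Rle_trans with (iter m y); [now apply IH | now apply iter_S_ge with n].
    + intros k Es Ha. eapply Rle_trans; [| now apply iter_S_block with (1 := Hy) (2 := Ha)].
      apply Rmult_le_compat_l; [left; apply w_range, (adm_successive _ _ Ha) |].
      apply sumk_le. intros j _. apply IH; [now apply supp_restrict |].
      intro i. unfold restrict. destruct (in_dec _ i (Es j)); [apply Hxy | lra].
Qed.

Lemma iter_add (m n : nat) (x y : seqR) : supp n x -> supp n y ->
  iter m (vadd x y) <= iter m x + iter m y.
Proof.
  revert x y. induction m as [| m IH]; intros x y Hx Hy.
  - assert (Hxy : supp n (vadd x y)).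
    { intros i Hi. unfold vadd. rewrite (Hx i Hi), (Hy i Hi). lra. }
    apply (supnorm_bounds n _ Hxy). intro i. unfold vadd.
    apply Rle_trans with (1 := Rabs_triang _ _).
    apply Rplus_le_compat; now apply (supnorm_bounds n).
  - apply iter_S_le.
    + apply Rle_trans with (1 := IH x y Hx Hy).
      apply Rplus_le_compat; now apply iter_S_ge with n.
    + intros k Es Ha.
      apply Rle_trans with (w k * sumk k (fun j => iter m (restrict (Es j) x))
                            + w k * sumk k (fun j => iter m (restrict (Es j) y))).
      * rewrite <- Rmult_plus_distr_l, <- sumk_add.
        apply Rmult_le_compat_l; [left; apply w_range, (adm_successive _ _ Ha) |].
        apply sumk_le. intros j _.
        replace (restrict (Es j) (vadd x y))
          with (vadd (restrict (Es j) x) (restrict (Es j) y)).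
        { apply IH; now apply supp_restrict. }
        extensionality i. unfold vadd, restrict. destruct (in_dec _ i (Es j)); lra.
      * apply Rplus_le_compat; now apply iter_S_block with n.
Qed.

Lemma iter_scal (m n : nat) (c : R) (x : seqR) : 0 <= c -> supp n x ->
  iter m (fun i => c * x i) <= c * iter m x.
Proof.
  intro Hc. revert x. induction m as [| m IH]; intros x Hx.
  - assert (Hcx : supp n (fun i => c * x i)).
    { intros i Hi. rewrite (Hx i Hi). lra. }
    apply (supnorm_bounds n _ Hcx). intro i.
    rewrite Rabs_mult, (Rabs_pos_eq c) by assumption.
    apply Rmult_le_compat_l; [assumption |]. now apply (supnorm_bounds n).
  - apply iter_S_le.
    + apply Rle_trans with (1 := IH x Hx). apply Rmult_le_compat_l; [assumption |].
      now apply iter_S_ge with n.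
    + intros k Es Ha.
      apply Rle_trans with (c * (w k * sumk k (fun j => iter m (restrict (Es j) x)))).
      * rewrite <- Rmult_assoc, (Rmult_comm c), Rmult_assoc, <- (sumk_scal k c).
        apply Rmult_le_compat_l; [left; apply w_range, (adm_successive _ _ Ha) |].
        apply sumk_le. intros j _.
        replace (restrict (Es j) (fun i => c * x i))
          with (fun i => c * restrict (Es j) x i).
        { apply IH. now apply supp_restrict. }
        extensionality i. unfold restrict. destruct (in_dec _ i (Es j)); lra.
      * apply Rmult_le_compat_l; [assumption |]. now apply iter_S_block with n.
Qed.

Lemma iter_le_norm (m n : nat) (x : seqR) : supp n x -> iter m x <= N x.
Proof.
  intro Hx. apply Rsup_ub with (l1 n x); [| now exists m].
  intros y [m' ->]. now apply iter_bounds.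
Qed.

Lemma norm_le (x : seqR) (b : R) : (forall m, iter m x <= b) -> N x <= b.
Proof.
  intro H. apply Rsup_le with (iter 0 x); [now exists 0%nat |].
  intros y [m ->]. apply H.
Qed.

Lemma norm_le_l1 (n : nat) (x : seqR) : supp n x -> N x <= l1 n x.
Proof. intro H. apply norm_le. intro m. now apply iter_bounds. Qed.

Lemma norm_coord (n : nat) (x : seqR) (i : nat) : supp n x -> Rabs (x i) <= N x.
Proof.
  intro H. apply Rle_trans with (iter 0 x); [| now apply iter_le_norm with n].
  now apply (supnorm_bounds n x H).
Qed.

Lemma norm_nonneg (n : nat) (x : seqR) : supp n x -> 0 <= N x.
Proof.
  intro H. apply Rle_trans with (Rabs (x 0%nat)); [apply Rabs_pos |].
  now apply norm_coord with n.
Qed.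

Lemma norm_mono (n : nat) (x y : seqR) : supp n y ->
  (forall i, Rabs (x i) <= Rabs (y i)) -> N x <= N y.
Proof.
  intros Hy H. apply norm_le. intro m.
  apply Rle_trans with (iter m y); [now apply iter_mono with n | now apply iter_le_norm with n].
Qed.

Lemma norm_add (n : nat) (x y : seqR) : supp n x -> supp n y -> N (vadd x y) <= N x + N y.
Proof.
  intros Hx Hy. apply norm_le. intro m.
  apply Rle_trans with (1 := iter_add m n x y Hx Hy).
  apply Rplus_le_compat; now apply iter_le_norm with n.
Qed.

Lemma norm_scal (n : nat) (c : R) (x : seqR) : 0 <= c -> supp n x ->
  N (fun i => c * x i) <= c * N x.
Proof.
  intros Hc Hx. apply norm_le. intro m.
  apply Rle_trans with (1 := iter_scal m n c x Hc Hx).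
  apply Rmult_le_compat_l; [assumption |]. now apply iter_le_norm with n.
Qed.

Lemma norm_zero (x : seqR) : (forall i, x i = 0) -> N x <= 0.
Proof. intro H. apply (norm_le_l1 0). intros i _. apply H. Qed.

Lemma norm_blocks_approx (n k : nat) (Es : nat -> list nat) (x : seqR) (eps : R) :
  supp n x -> 0 < eps ->
  exists m, forall j, (j < k)%nat -> N (restrict (Es j) x) - eps <= iter m (restrict (Es j) x).
Proof.
  intros Hx He. induction k as [| k [m IH]]; [exists 0%nat; intros; lia |].
  destruct (Rsup_approx (fun r => exists m, r = iter m (restrict (Es k) x))
    (iter 0 (restrict (Es k) x)) (l1 n (restrict (Es k) x)) eps)
    as [y [[m' ->] Hy]]; [now exists 0%nat | | assumption |].
  { intros y [m' ->]. now apply iter_bounds, supp_restrict. }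
  exists (max m m'). intros j Hj. destruct (Nat.eq_dec j k) as [-> | h].
  - apply Rle_trans with (iter m' (restrict (Es k) x)); [left; exact Hy |].
    apply iter_mono_index with n; [now apply supp_restrict | lia].
  - apply Rle_trans with (1 := IH j ltac:(lia)).
    apply iter_mono_index with n; [now apply supp_restrict | lia].
Qed.

Lemma norm_block (n k : nat) (Es : nat -> list nat) (x : seqR) : supp n x -> adm k Es ->
  w k * sumk k (fun j => N (restrict (Es j) x)) <= N x.
Proof.
  intros Hx Ha. apply Rnot_lt_le. intro Hlt.
  assert (Hk := proj1 (adm_successive _ _ Ha)). assert (Hw := w_range k Hk).
  assert (Hk0 : 0 < INR k) by (apply lt_0_INR; lia).
  set (s := sumk k (fun j => N (restrict (Es j) x))) in *.
  set (eps := (w k * s - N x) / (2 * INR k)).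
  assert (He : 0 < eps) by (apply Rdiv_lt_0_compat; lra).
  destruct (norm_blocks_approx n k Es x eps Hx He) as [m Hm].
  assert (H1 := Rle_trans _ _ _ (iter_S_block n m k Es x Hx Ha) (iter_le_norm _ _ _ Hx)).
  assert (H2 : s + INR k * (- eps) <= sumk k (fun j => iter m (restrict (Es j) x))).
  { unfold s. rewrite <- sumk_const, <- sumk_add. apply sumk_le.
    intros j Hj. specialize (Hm j Hj). lra. }
  assert (H3 : INR k * eps = (w k * s - N x) / 2) by (unfold eps; field; lra).
  nra.
Qed.

Hypothesis adm_far : forall k Es, successive k Es ->
  (forall a, In a (Es 0%nat) -> (k <= S a)%nat) -> adm k Es.
Hypothesis w_slow : forall delta, 0 < delta -> exists c, 0 < c /\
  forall k, (1 <= k)%nat -> c * Rpower (INR k) (- delta) <= w k.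

Lemma weight_sum_unbounded (B : R) : exists k, (1 <= k)%nat /\ B < w k * INR k.
Proof.
  destruct (w_slow (1 / 4) ltac:(lra)) as [c [Hc Hw]].
  destruct (power_growth c (Rabs B) (3 / 4) (1 / 4) Hc (Rabs_pos B) ltac:(lra))
    as [k [Hk HkB]].
  exists k. split; [assumption |]. specialize (Hw k Hk).
  assert (Hk1 : 1 <= INR k) by (apply (le_INR 1); assumption).
  assert (H1 : 1 <= Rpower (INR k) (1 / 4)).
  { apply Rle_trans with (Rpower (INR k) 0); [rewrite Rpower_O; lra |].
    apply Rle_Rpower; lra. }
  assert (H2 : Rpower (INR k) (3 / 4) = Rpower (INR k) (- (1 / 4)) * INR k).
  { rewrite <- (Rpower_1 (INR k)) at 3 by lra. rewrite <- Rpower_plus. f_equal. lra. }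
  assert (H3 := Rle_abs B). assert (H4 := Rabs_pos B).
  assert (H5 : Rabs B <= Rabs B * Rpower (INR k) (1 / 4)) by nra.
  assert (H6 := Rmult_le_compat_r (INR k) _ _ ltac:(lra) Hw).
  rewrite H2 in HkB. lra.
Qed.

(* Otherwise there are infinitely many successive blocks of norm at least [eps],
   and [k] of them placed beyond [k] have a sum of norm at least [w k * k * eps]. *)
Lemma boundedly_complete (B : R) (z : seqR) : (forall n, N (proj n z) <= B) ->
  forall eps, 0 < eps -> exists n0, forall n, N (proj n (tail n0 z)) <= eps.
Proof.
  intros HB eps He. apply NNPP. intro Hno.
  assert (Hch : forall a, exists b, eps < N (proj b (tail a z))).
  { intro a. apply NNPP. intro h. apply Hno. exists a. intro b.
    apply Rnot_lt_le. intro. apply h. now exists b. }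
  set (phi := fun a => proj1_sig (constructive_indefinite_description _ (Hch a))).
  assert (Hphi : forall a, eps < N (proj (phi a) (tail a z))).
  { intro a. unfold phi. now destruct (constructive_indefinite_description _ (Hch a)). }
  assert (Hlt : forall a, (a < phi a)%nat).
  { intro a. apply Nat.nle_gt. intro h.
    assert (N (proj (phi a) (tail a z)) <= 0); [| specialize (Hphi a); lra].
    apply norm_zero. intro i. unfold proj, tail.
    destruct (Nat.ltb_spec i (phi a)), (Nat.ltb_spec i a); (lia || reflexivity). }
  destruct (weight_sum_unbounded (B / eps)) as [k [Hk HkB]].
  set (s := fun j => Nat.iter j phi k).
  assert (Hs : forall j, (s j < s (S j))%nat) by (intro; apply Hlt).
  assert (Hs' : forall i j, (i <= j)%nat -> (s i <= s j)%nat).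
  { intros i j Hij. induction Hij as [| j _ IH]; [lia | specialize (Hs j); lia]. }
  set (Es := fun j => seq (s j) (s (S j) - s j)).
  assert (HIn : forall j a, In a (Es j) <-> (s j <= a < s (S j))%nat).
  { intros j a. unfold Es. rewrite in_seq. specialize (Hs j). lia. }
  assert (Ha : adm k Es).
  { apply adm_far.
    - split; [assumption | split].
      + intros j _ h. apply (in_nil (a := s j)). rewrite <- h. apply HIn. specialize (Hs j). lia.
      + intros i j Hij _ a b HaE HbE. apply HIn in HaE, HbE.
        specialize (Hs' (S i) j ltac:(lia)). lia.
    - intros a HaE. apply HIn in HaE. unfold s in HaE; simpl in HaE. lia. }
  assert (H1 := norm_block (s k) k Es (proj (s k) z) (supp_proj _ _) Ha).
  assert (H2 : sumk k (fun _ => eps) <= sumk k (fun j => N (restrict (Es j) (proj (s k) z)))).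
  { apply sumk_le. intros j Hj.
    apply Rle_trans with (N (proj (s (S j)) (tail (s j) z))); [left; apply Hphi |].
    apply norm_mono with (s k); [apply supp_restrict, supp_proj |]. intro i.
    assert (L := Hs' (S j) k ltac:(lia)). assert (L' := HIn j i).
    unfold restrict, proj, tail.
    destruct (in_dec Nat.eq_dec i (Es j)) as [h | h], (Nat.ltb_spec i (s (S j))),
      (Nat.ltb_spec i (s j)), (Nat.ltb_spec i (s k)); try lia; try lra.
    all: rewrite ?Rabs_R0; try apply Rabs_pos; try lra; exfalso; apply h, L'; lia. }
  rewrite sumk_const in H2. specialize (HB (s k)).
  assert (Hw := w_range k Hk).
  assert (B < w k * INR k * eps); [| nra].
  replace B with (B / eps * eps) by (field; lra). nra.
Qed.

(** * Convexifications *)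

(* [nb q B x] says that the [q]-th power of the norm of [x] in the
   [q]-convexification is at most [B]. *)
Definition nb (q B : R) (x : seqR) : Prop := forall n, N (proj n (abs_pow q x)) <= B.

Lemma abs_proj_abs_pow (q : R) (n : nat) (x : seqR) (i : nat) :
  Rabs (proj n (abs_pow q x) i) = proj n (abs_pow q x) i.
Proof.
  apply Rabs_pos_eq. unfold proj, abs_pow. destruct (Nat.ltb i n); [apply pw_nonneg | lra].
Qed.

Lemma nb_dominated (q c1 c2 A B : R) (x y z : seqR) : 0 <= c1 -> 0 <= c2 ->
  (forall i, pw (Rabs (x i)) q <= c1 * pw (Rabs (y i)) q + c2 * pw (Rabs (z i)) q) ->
  nb q A y -> nb q B z -> nb q (c1 * A + c2 * B) x.
Proof.
  intros H1 H2 H Hy Hz n. specialize (Hy n). specialize (Hz n).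
  set (u := fun i => c1 * proj n (abs_pow q y) i).
  set (v := fun i => c2 * proj n (abs_pow q z) i).
  assert (Hu : supp n u) by (intros i Hi; unfold u; rewrite (supp_proj n _ i Hi); lra).
  assert (Hv : supp n v) by (intros i Hi; unfold v; rewrite (supp_proj n _ i Hi); lra).
  assert (N u <= c1 * N (proj n (abs_pow q y)))
    by (apply norm_scal with n; [assumption | apply supp_proj]).
  assert (N v <= c2 * N (proj n (abs_pow q z)))
    by (apply norm_scal with n; [assumption | apply supp_proj]).
  assert (N (proj n (abs_pow q x)) <= N u + N v); [| nra].
  apply Rle_trans with (2 := norm_add n u v Hu Hv).
  apply norm_mono with n.
  - intros i Hi. unfold vadd. rewrite (Hu i Hi), (Hv i Hi). lra.
  - intro i. rewrite abs_proj_abs_pow. apply Rle_trans with (2 := Rle_abs _).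
    unfold vadd, u, v, proj. destruct (Nat.ltb i n); [apply H | lra].
Qed.

Lemma nb_nonneg (q B : R) (x : seqR) : nb q B x -> 0 <= B.
Proof.
  intro H. apply Rle_trans with (2 := H 0%nat).
  apply norm_nonneg with 0%nat. apply supp_proj.
Qed.

Lemma nb_weaken (q A B : R) (x : seqR) : A <= B -> nb q A x -> nb q B x.
Proof. intros H Hx n. specialize (Hx n). lra. Qed.

Lemma nb_coord (q B : R) (x : seqR) (i : nat) : nb q B x -> pw (Rabs (x i)) q <= B.
Proof.
  intro H. apply Rle_trans with (2 := H (S i)).
  apply Rle_trans with (2 := norm_coord (S i) _ i (supp_proj _ _)).
  rewrite abs_proj_abs_pow. unfold proj. destruct (Nat.ltb_spec i (S i)); [| lia].
  unfold abs_pow. lra.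
Qed.

Lemma nb_mono (q B : R) (x y : seqR) : 0 < q ->
  (forall i, Rabs (x i) <= Rabs (y i)) -> nb q B y -> nb q B x.
Proof.
  intros Hq H Hy.
  replace B with (1 * B + 0 * B) by lra.
  apply nb_dominated with y y; try lra; try assumption.
  intro i. assert (P := pw_le _ _ q Hq (Rabs_pos (x i)) (H i)). lra.
Qed.

Lemma nb_add (q delta : R) : 0 < q -> 0 < delta -> exists C, 0 <= C /\ forall A B x y,
  nb q A x -> nb q B y -> nb q ((1 + delta) * A + C * B) (vadd x y).
Proof.
  intros Hq Hd. destruct (pw_add_le q delta Hq Hd) as [C [HC H]].
  exists C. split; [assumption |]. intros A B x y Hx Hy.
  apply nb_dominated with x y; try lra; try assumption.
  intro i. apply H.
Qed.

Lemma nb_head (q eps : R) (n : nat) (x : seqR) : 0 < q -> 0 <= eps ->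
  (forall i, (i < n)%nat -> Rabs (x i) <= pw eps (/ q)) -> nb q (INR n * eps) (proj n x).
Proof.
  intros Hq He H m. rewrite <- sumk_const.
  assert (Hz : forall i, (n <= i)%nat -> proj m (abs_pow q (proj n x)) i = 0).
  { intros i Hi. unfold proj, abs_pow. destruct (Nat.ltb i m); [| reflexivity].
    destruct (Nat.ltb_spec i n); [lia |]. rewrite Rabs_R0. apply pw_0. }
  apply Rle_trans with (1 := norm_le_l1 n _ Hz). apply sumk_le. intros i Hi.
  rewrite abs_proj_abs_pow. unfold proj at 1. destruct (Nat.ltb i m); [| assumption].
  unfold abs_pow, proj. destruct (Nat.ltb_spec i n); [| lia].
  rewrite <- (pw_inv_r eps q) by assumption.
  apply pw_le; [assumption | apply Rabs_pos | now apply H].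
Qed.

Lemma nb_tail (q B eps : R) (x : seqR) : nb q B x -> 0 < eps ->
  exists n0, nb q eps (tail n0 x).
Proof.
  intros H He. destruct (boundedly_complete B _ H eps He) as [n0 Hn0].
  exists n0. intro n. replace (abs_pow q (tail n0 x)) with (tail n0 (abs_pow q x)); [apply Hn0 |].
  extensionality i. unfold tail, abs_pow. destruct (Nat.ltb i n0); [| reflexivity].
  rewrite Rabs_R0. now rewrite pw_0.
Qed.

Section Concentration.

Variable U : (nat -> Prop) -> Prop.
Hypothesis HU : free_ultrafilter U.
Variable q : R.
Hypothesis Hq : 0 < q.

Definition ultra_lim (x : nat -> seqR) (u : seqR) : Prop :=
  forall i eps, 0 < eps -> U (fun m => Rabs (x m i - u i) < eps).

Lemma ultra_lim_head (x : nat -> seqR) (u : seqR) (n : nat) (eps : R) :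
  ultra_lim x u -> 0 < eps -> U (fun m => forall i, (i < n)%nat -> Rabs (x m i - u i) < eps).
Proof.
  intros H He.
  apply (uf_forall_lt U HU (fun i m => Rabs (x m i - u i) < eps)).
  intros i _. now apply H.
Qed.

Lemma ultra_lim_sub (x y : nat -> seqR) (u v : seqR) :
  ultra_lim x u -> ultra_lim y v -> ultra_lim (fun m => vsub (x m) (y m)) (vsub u v).
Proof.
  intros Hx Hy i eps He.
  apply (uf_sub U HU) with
    (2 := uf_and U HU _ _ (Hx i (eps / 2) ltac:(lra)) (Hy i (eps / 2) ltac:(lra))).
  intros n [h1 h2]. unfold vsub.
  replace (x n i - y n i - (u i - v i)) with ((x n i - u i) + - (y n i - v i)) by ring.
  apply Rle_lt_trans with (1 := Rabs_triang _ _). rewrite Rabs_Ropp. lra.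
Qed.

Lemma ultra_lim_const (u : seqR) : ultra_lim (fun _ => u) u.
Proof.
  intros i eps He. apply (uf_sub U HU) with (2 := uf_cof U HU 0).
  intros n _. rewrite Rminus_diag, Rabs_R0. assumption.
Qed.

Lemma nb_ultra_lim (x : nat -> seqR) (u : seqR) (B : R) :
  ultra_lim x u -> (forall m, nb q B (x m)) -> nb q B u.
Proof.
  intros Hl HB n. apply Rnot_lt_le. intro Hlt.
  set (d := N (proj n (abs_pow q u)) - B) in *.
  assert (HB0 := nb_nonneg q B _ (HB 0%nat)).
  assert (Hd : 0 < d) by (unfold d; lra).
  set (delta := d / (4 * (B + 1))).
  assert (Hdelta : 0 < delta) by (apply Rdiv_lt_0_compat; lra).
  destruct (nb_add q delta Hq Hdelta) as [C [HC Hadd]].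
  set (eps := d / (4 * (C + 1) * (INR n + 1))).
  assert (Hn := pos_INR n).
  assert (Heps : 0 < eps) by (apply Rdiv_lt_0_compat; [lra | apply Rmult_lt_0_compat; lra]).
  assert (Hr : 0 < pw eps (/ q)) by now apply pw_gt0.
  destruct (uf_ex U HU _ (ultra_lim_head x u n _ Hl Hr)) as [m Hm].
  assert (Hh : nb q (INR n * eps) (proj n (vsub u (x m)))).
  { apply nb_head; [assumption | lra |]. intros i Hi. left. unfold vsub.
    rewrite Rabs_minus_sym. now apply Hm. }
  assert (H := Hadd _ _ _ _ (HB m) Hh n).
  assert (Heq : proj n (abs_pow q (vadd (x m) (proj n (vsub u (x m))))) = proj n (abs_pow q u)).
  { extensionality i. unfold proj, abs_pow, vadd, vsub. destruct (Nat.ltb i n); [| reflexivity].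
    do 2 f_equal. ring. }
  rewrite Heq in H.
  assert (E1 : delta * (B + 1) = d / 4) by (unfold delta; field; lra).
  assert (E2 : (C + 1) * ((INR n + 1) * eps) = d / 4) by (unfold eps; field; lra).
  assert (C * (INR n * eps) <= (C + 1) * ((INR n + 1) * eps)).
  { apply Rmult_le_compat; try nra. }
  assert (N (proj n (abs_pow q u)) = B + d) by (unfold d; ring).
  nra.
Qed.

(* Asymptotic smoothness: a bounded coordinatewise null sequence is eventually
   almost disjoint from [y], and [q]-th powers of norms add up on disjoint vectors. *)
Lemma nb_add_null (A K : R) (y : seqR) (z : nat -> seqR) : nb q A y ->
  (forall m, nb q K (z m)) -> ultra_lim z (fun _ => 0) ->
  U (fun m => nb q (A + (K + 1)) (vadd y (z m))).
Proof.
  intros Hy Hz Hl.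
  assert (HA := nb_nonneg _ _ _ Hy). assert (HK := nb_nonneg _ _ _ (Hz 0%nat)).
  set (delta := / (2 * (A + K + 1))).
  assert (Hdelta : 0 < delta) by (apply Rinv_0_lt_compat; lra).
  destruct (nb_add q delta Hq Hdelta) as [C [HC Hadd]].
  set (eps := / (4 * (C + 1))).
  assert (Heps : 0 < eps) by (apply Rinv_0_lt_compat; lra).
  destruct (nb_tail q A eps y Hy Heps) as [n Hn].
  assert (Hn0 := pos_INR n).
  set (eps' := eps / (INR n + 1)).
  assert (Heps' : 0 < eps') by (apply Rdiv_lt_0_compat; lra).
  assert (Hr : 0 < pw eps' (/ q)) by now apply pw_gt0.
  apply (uf_sub U HU) with (2 := ultra_lim_head z _ n _ Hl Hr).
  intros m Hm.
  set (a := fun i => if Nat.ltb i n then y i else z m i).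
  set (b := fun i => if Nat.ltb i n then z m i else y i).
  assert (Ha : nb q (1 * A + 1 * K) a).
  { apply nb_dominated with y (z m); try lra; try assumption; [| apply Hz].
    intro i. assert (P := pw_nonneg (Rabs (y i)) q). assert (P' := pw_nonneg (Rabs (z m i)) q).
    unfold a. destruct (Nat.ltb i n); lra. }
  assert (Hh : nb q (INR n * eps') (proj n (z m))).
  { apply nb_head; [assumption | lra |]. intros i Hi. specialize (Hm i Hi).
    rewrite Rminus_0_r in Hm. lra. }
  assert (Hb : nb q (1 * eps + 1 * (INR n * eps')) b).
  { apply nb_dominated with (tail n y) (proj n (z m)); try lra; try assumption.
    intro i. assert (P := pw_nonneg (Rabs (tail n y i)) q).
    assert (P' := pw_nonneg (Rabs (proj n (z m) i)) q).
    unfold b, tail, proj in *. destruct (Nat.ltb i n); lra. }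
  assert (H := Hadd _ _ _ _ Ha Hb).
  replace (vadd a b) with (vadd y (z m)) in H
    by (extensionality i; unfold vadd, a, b; destruct (Nat.ltb i n); lra).
  revert H. apply nb_weaken.
  assert (E1 : delta * (A + K + 1) = / 2) by (unfold delta; field; lra).
  assert (E2 : (C + 1) * eps = / 4) by (unfold eps; field; lra).
  assert (E3 : INR n * eps' + eps' = eps) by (unfold eps'; field; lra).
  assert (C * (1 * eps + 1 * (INR n * eps')) <= (C + 1) * (2 * eps))
    by (apply Rmult_le_compat; nra).
  nra.
Qed.

Definition increasing_from (n0 : nat) (l : list nat) : Prop :=
  (forall i j, (i < j)%nat -> (j < length l)%nat -> (nth i l 0 < nth j l 0)%nat) /\
  (forall a, In a l -> (n0 <= a)%nat).

Lemma increasing_from_snoc (n0 : nat) (l : list nat) (a : nat) :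
  increasing_from n0 l -> (n0 <= a)%nat -> (list_max l < a)%nat -> increasing_from n0 (l ++ a :: nil).
Proof.
  intros [H1 H2] Ha Hm. split.
  - intros i j Hij Hj. rewrite length_app in Hj; simpl in Hj.
    rewrite app_nth1 by lia. destruct (Nat.eq_dec j (length l)) as [-> | h].
    + rewrite nth_middle. apply Nat.le_lt_trans with (2 := Hm).
      assert (F := proj1 (list_max_le l _) (Nat.le_refl _)).
      rewrite Forall_forall in F. apply F, nth_In. lia.
    + rewrite app_nth1 by lia. apply H1; lia.
  - intros b Hb. apply in_app_or in Hb. destruct Hb as [Hb | [<- | []]]; auto.
Qed.

(* The centre [u] is the iterated limit of [F], the last entry going to infinity first. *)
Lemma concentration (K : R) (k : nat) : forall F : list nat -> seqR,
  (forall l1 l2 a b, length l1 + S (length l2) = k ->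
     nb q K (vsub (F (l1 ++ a :: l2)) (F (l1 ++ b :: l2))))%nat ->
  exists u, forall n0, exists l, length l = k /\ increasing_from n0 l /\
    nb q (INR k * (K + 1)) (vsub (F l) u).
Proof.
  induction k as [| k IH]; intros F HF.
  - exists (F nil). intro n0. exists nil. split; [reflexivity | split].
    + split; [simpl; intros; lia | intros a []].
    + intro n. simpl. rewrite Rmult_0_l. apply norm_zero. intro i.
      unfold proj, abs_pow, vsub. destruct (Nat.ltb i n); [| reflexivity].
      now rewrite Rminus_diag, Rabs_R0, pw_0.
  - assert (HF1 : forall l a b, length l = k ->
        nb q K (vsub (F (l ++ a :: nil)) (F (l ++ b :: nil)))).
    { intros l a b Hl. apply HF. simpl. lia. }
    assert (HlimC : forall l i, exists L, length l = k -> forall eps, 0 < eps ->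
        U (fun m => Rabs (F (l ++ m :: nil) i - L) < eps)).
    { intros l i. destruct (Nat.eq_dec (length l) k) as [Hl | Hl]; [| exists 0; intro; lia].
      destruct (ultra_limit U HU (fun m => F (l ++ m :: nil) i)
        (pw K (/ q) + Rabs (F (l ++ 0%nat :: nil) i))) as [L HL]; [| now exists L].
      intro m. assert (H := nb_coord q K _ i (HF1 l m 0%nat Hl)). unfold vsub in H.
      assert (H' : Rabs (F (l ++ m :: nil) i - F (l ++ 0%nat :: nil) i) <= pw K (/ q)).
      { set (t := Rabs _) in *. assert (Ht : 0 <= t) by apply Rabs_pos.
        assert (P : pw (pw t q) (/ q) <= pw K (/ q)).
        { apply pw_le; [now apply Rinv_0_lt_compat | apply pw_nonneg | assumption]. }
        rewrite pw_pw, Rinv_r, pw_exp1 in P by lra. assumption. }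
      replace (F (l ++ m :: nil) i) with
        ((F (l ++ m :: nil) i - F (l ++ 0%nat :: nil) i) + F (l ++ 0%nat :: nil) i) by ring.
      apply Rle_trans with (1 := Rabs_triang _ _). lra. }
    set (G := fun l i => proj1_sig (constructive_indefinite_description _ (HlimC l i))).
    assert (HG : forall l, length l = k -> ultra_lim (fun m => F (l ++ m :: nil)) (G l)).
    { intros l Hl i. unfold G.
      destruct (constructive_indefinite_description _ (HlimC l i)) as [L HL]; simpl; auto. }
    destruct (IH G) as [u Hu].
    { intros l1 l2 a b Hl.
      assert (La : length (l1 ++ a :: l2) = k) by (rewrite length_app; exact Hl).
      assert (Lb : length (l1 ++ b :: l2) = k) by (rewrite length_app; exact Hl).
      apply (nb_ultra_lim _ _ K (ultra_lim_sub _ _ _ _ (HG _ La) (HG _ Lb))).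
      intro m. rewrite <- !app_assoc. simpl. apply HF. rewrite length_app. simpl. lia. }
    exists u. intro n0. destruct (Hu n0) as [l [Hl [Hinc Hnb]]].
    set (z := fun m => vsub (F (l ++ m :: nil)) (G l)).
    assert (Hz : forall m, nb q K (z m)).
    { intro m. apply (nb_ultra_lim _ _ K
        (ultra_lim_sub _ _ _ _ (ultra_lim_const (F (l ++ m :: nil))) (HG l Hl))).
      intro m'. now apply HF1. }
    assert (Hz0 : ultra_lim z (fun _ => 0)).
    { intros i eps He. apply (uf_sub U HU) with (2 := HG l Hl i eps He).
      intros m Hm. unfold z, vsub. now rewrite Rminus_0_r. }
    assert (HA := nb_add_null _ K _ z Hnb Hz Hz0).
    destruct (uf_ex U HU _ (uf_and U HU _ _ HA (uf_cof U HU (n0 + S (list_max l)))))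
      as [a [Ha Han]].
    exists (l ++ a :: nil). split; [rewrite length_app; simpl; lia | split].
    + apply increasing_from_snoc; [assumption | lia | lia].
    + rewrite S_INR. replace ((INR k + 1) * (K + 1)) with (INR k * (K + 1) + (K + 1)) by ring.
      replace (vsub (F (l ++ a :: nil)) u) with (vadd (vsub (G l) u) (z a)); [assumption |].
      extensionality i. unfold vadd, z, vsub. ring.
Qed.

End Concentration.

Lemma compl_norm_le (q B : R) (x : seqR) : nb q B x -> compl_norm N (abs_pow q x) <= B.
Proof.
  intro H. apply Rsup_le with (N (proj 0 (abs_pow q x))); [now exists 0%nat |].
  intros y [n ->]. apply H.
Qed.

Lemma nb_compl_norm (q B : R) (x : seqR) : nb q B x -> nb q (compl_norm N (abs_pow q x)) x.
Proof.
  intros H n. apply Rsup_ub with B; [| now exists n]. intros y [m ->]. apply H.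
Qed.

Lemma in_conv_nb (q : R) (x : seqR) : in_conv N q x -> exists B, nb q B x.
Proof.
  intro H. destruct (H 1 ltac:(lra)) as [n0 Hn0].
  set (z := abs_pow q x) in *. exists (N (proj n0 z) + 1). intro n. fold z.
  assert (Hm : forall m, (n0 <= m)%nat -> N (proj m z) <= N (proj n0 z) + 1).
  { intros m Hm. specialize (Hn0 m n0 Hm (Nat.le_refl _)).
    replace (proj m z) with (vadd (proj n0 z) (vsub (proj m z) (proj n0 z)))
      by (extensionality i; unfold vadd, vsub; ring).
    assert (S0 : supp m (proj n0 z)).
    { intros i Hi. apply (supp_proj n0 z). lia. }
    assert (S1 : supp m (vsub (proj m z) (proj n0 z))).
    { intros i Hi. unfold vsub. rewrite (S0 i Hi), (supp_proj m z i Hi). ring. }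
    assert (P := norm_add m _ _ S0 S1). lra. }
  apply Rle_trans with (2 := Hm (max n0 n) ltac:(lia)).
  apply norm_mono with (max n0 n); [apply supp_proj |].
  intro i. unfold proj.
  destruct (Nat.ltb_spec i n), (Nat.ltb_spec i (max n0 n)); try lia; try lra.
  rewrite Rabs_R0. apply Rabs_pos.
Qed.

Lemma finite_in_conv (q : R) (n : nat) (x : seqR) : supp n x -> in_conv N q x.
Proof.
  intros H eps He. exists n. intros a b Ha Hb. apply Rle_lt_trans with 0; [| assumption].
  apply norm_zero. intro i. unfold vsub, proj, abs_pow.
  destruct (Nat.lt_ge_cases i n) as [h | h].
  - destruct (Nat.ltb_spec i a), (Nat.ltb_spec i b); lia || ring.
  - rewrite (H i h), Rabs_R0, pw_0. destruct (Nat.ltb i a), (Nat.ltb i b); ring.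
Qed.

Lemma nb_sub (q : R) : 0 < q -> exists C, 0 <= C /\ forall A B x y,
  nb q A x -> nb q B y -> nb q (C * (A + B)) (vsub x y).
Proof.
  intro Hq. destruct (nb_add q 1 Hq ltac:(lra)) as [C [HC H]].
  exists (2 + C). split; [lra |]. intros A B x y Hx Hy.
  assert (Hy' : nb q B (fun i => - y i)).
  { apply nb_mono with y; [assumption | | assumption]. intro i. rewrite Rabs_Ropp. lra. }
  assert (HA := nb_nonneg _ _ _ Hx). assert (HB := nb_nonneg _ _ _ Hy).
  apply nb_weaken with (2 := H _ _ _ _ Hx Hy'). nra.
Qed.

Lemma conv_dist_le (q A : R) (x y : seqR) : 0 < q -> nb q A (vsub x y) ->
  conv_dist N q x y <= pw A (/ q).
Proof.
  intros Hq H. apply pw_le; [now apply Rinv_0_lt_compat | | now apply compl_norm_le].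
  apply nb_nonneg with q (vsub x y). now apply nb_compl_norm with A.
Qed.

Lemma nb_conv_dist (q A : R) (x y : seqR) : 0 < q -> nb q A (vsub x y) ->
  nb q (pw (conv_dist N q x y) q) (vsub x y).
Proof.
  intros Hq H. unfold conv_dist, conv_norm.
  assert (P := nb_compl_norm q A _ H).
  rewrite pw_inv_r; [assumption | assumption |]. now apply nb_nonneg with (1 := P).
Qed.

Lemma in_conv_sub_nb (q : R) (x y : seqR) : 0 < q -> in_conv N q x -> in_conv N q y ->
  exists A, nb q A (vsub x y).
Proof.
  intros Hq Hx Hy.
  destruct (in_conv_nb q x Hx) as [A HA], (in_conv_nb q y Hy) as [B HB].
  destruct (nb_sub q Hq) as [C [_ HC]]. exists (C * (A + B)). now apply HC.
Qed.

Definition vec (l : list nat) : seqR := fun i => INR (count_occ Nat.eq_dec l i).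

Lemma supp_vec (l : list nat) : supp (S (list_max l)) (vec l).
Proof.
  intros i Hi. unfold vec. rewrite (proj1 (count_occ_not_In Nat.eq_dec l i)); [reflexivity |].
  intro h. assert (F := proj1 (list_max_le l _) (Nat.le_refl _)).
  rewrite Forall_forall in F. specialize (F i h). lia.
Qed.

Lemma vec_in_conv (q : R) (l : list nat) : in_conv N q (vec l).
Proof. apply finite_in_conv with (1 := supp_vec l). Qed.

Lemma vec_adjacent (p : R) (l1 l2 : list nat) (a b : nat) : 0 < p ->
  nb p 2 (vsub (vec (l1 ++ a :: l2)) (vec (l1 ++ b :: l2))).
Proof.
  intros Hp n. apply Rle_trans with (1 := norm_le_l1 n _ (supp_proj _ _)).
  apply Rle_trans with (sumk n (fun i => (if Nat.eq_dec i a then 1 else 0)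
                                        + (if Nat.eq_dec i b then 1 else 0))).
  - apply sumk_le. intros i Hi. rewrite abs_proj_abs_pow.
    unfold proj, abs_pow, vsub, vec. destruct (Nat.ltb_spec i n); [| lia].
    rewrite !count_occ_app, !plus_INR. simpl.
    destruct (Nat.eq_dec a i), (Nat.eq_dec b i), (Nat.eq_dec i a), (Nat.eq_dec i b);
      try congruence; rewrite ?S_INR;
      match goal with |- pw (Rabs ?t) p <= _ =>
        ring_simplify t end;
      rewrite ?Rabs_R0, ?Rabs_Ropp, ?Rabs_R1, ?pw_0, ?pw_1; lra.
  - rewrite sumk_add. assert (H1 := sumk_indicator n a). assert (H2 := sumk_indicator n b). lra.
Qed.

Lemma vec_separated (p : R) (l l' : list nat) : 0 < p -> (1 <= length l)%nat ->
  increasing_from (length l) l -> increasing_from (S (list_max l)) l' ->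
  w (length l) * INR (length l) <= compl_norm N (abs_pow p (vsub (vec l) (vec l'))).
Proof.
  intros Hp Hk [H1 H2] [_ H3]. set (k := length l) in *.
  set (x := vsub (vec l) (vec l')).
  destruct (in_conv_sub_nb p (vec l) (vec l') Hp (vec_in_conv p l) (vec_in_conv p l')) as [A HA].
  apply nb_compl_norm in HA. fold x in HA.
  set (n := S (list_max l)) in *.
  apply Rle_trans with (2 := HA n). set (y := proj n (abs_pow p x)).
  set (Es := fun j => nth j l 0%nat :: nil).
  assert (Hadm : adm k Es).
  { apply adm_far; [split; [assumption | split] |].
    - intros j _. discriminate.
    - intros i j Hij Hj a b [<- | []] [<- | []]. now apply H1.
    - intros a [<- | []]. assert (P := H2 (nth 0 l 0%nat) ltac:(now apply nth_In)). lia. }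
  apply Rle_trans with (2 := norm_block n k Es y (supp_proj _ _) Hadm).
  apply Rmult_le_compat_l; [left; now apply w_range |].
  rewrite <- (Rmult_1_r (INR k)), <- sumk_const. apply sumk_le. intros j Hj.
  set (i := nth j l 0%nat). assert (Hi : In i l) by now apply nth_In.
  assert (Hin : (i < n)%nat).
  { assert (F := proj1 (list_max_le l _) (Nat.le_refl _)).
    rewrite Forall_forall in F. specialize (F i Hi). unfold n. lia. }
  apply Rle_trans with (2 := norm_coord n _ i (supp_restrict n (Es j) y (supp_proj _ _))).
  unfold restrict. destruct (in_dec Nat.eq_dec i (Es j)) as [_ | h]; [| exfalso; apply h; now left].
  unfold y. rewrite abs_proj_abs_pow. unfold proj. destruct (Nat.ltb_spec i n); [| lia].
  unfold abs_pow, x, vsub.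
  assert (E : vec l' i = 0).
  { unfold vec. rewrite (proj1 (count_occ_not_In Nat.eq_dec l' i)); [reflexivity |].
    intro h. specialize (H3 i h). lia. }
  assert (E' : 1 <= vec l i).
  { apply (le_INR 1). apply (count_occ_In Nat.eq_dec) in Hi. lia. }
  rewrite E, Rminus_0_r, Rabs_pos_eq by lra.
  rewrite <- (pw_1 p) at 1. apply pw_le; lra.
Qed.

Lemma image_spread (p q B : R) (f : seqR -> seqR) : 1 <= p -> 0 < q ->
  (forall x, in_conv N p x -> in_conv N q (f x)) ->
  omega_le (in_conv N p) (conv_dist N p) (conv_dist N q) f 2 B ->
  exists D, 0 <= D /\ forall k, exists l l', length l = k /\
    increasing_from k l /\ increasing_from (S (list_max l)) l' /\
    conv_dist N q (f (vec l)) (f (vec l')) <= D * pw (INR k) (/ q).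
Proof.
  intros Hp Hq Hin Hom.
  assert (Hp0 : 0 < p) by lra.
  destruct free_ultrafilter_exists as [U HU].
  destruct (nb_sub q Hq) as [C [HC Hsub]].
  set (K := pw (Rmax B 0) q).
  assert (HK : 0 <= K) by apply pw_nonneg.
  exists (pw (C * 2 * (K + 1)) (/ q)). split; [apply pw_nonneg |]. intro k.
  destruct (concentration U HU q Hq K k (fun l => f (vec l))) as [u Hu].
  { intros l1 l2 a b _.
    set (x := vec (l1 ++ a :: l2)). set (y := vec (l1 ++ b :: l2)).
    destruct (in_conv_sub_nb q (f x) (f y) Hq) as [A HA]; [apply Hin, vec_in_conv .. |].
    apply nb_weaken with (2 := nb_conv_dist q A _ _ Hq HA).
    apply pw_le; [assumption | apply pw_nonneg |].
    apply Rle_trans with (2 := Rmax_l B 0).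
    apply Hom; [apply vec_in_conv | apply vec_in_conv |].
    apply Rle_trans with (1 := conv_dist_le p 2 _ _ Hp0 (vec_adjacent p l1 l2 a b Hp0)).
    rewrite pw_pos by lra. rewrite <- (Rpower_1 2) at 2 by lra. apply Rle_Rpower; [lra |].
    rewrite <- Rinv_1. apply Rinv_le_contravar; lra. }
  destruct (Hu k) as [l [Hl [Hinc Hnb]]].
  destruct (Hu (S (list_max l))) as [l' [_ [Hinc' Hnb']]].
  exists l, l'. repeat (split; [assumption |]).
  rewrite <- pw_mult; [| nra | apply pos_INR].
  apply conv_dist_le; [assumption |].
  replace (vsub (f (vec l)) (f (vec l')))
    with (vsub (vsub (f (vec l)) u) (vsub (f (vec l')) u))
    by (extensionality i; unfold vsub; ring).
  replace (C * 2 * (K + 1) * INR k) with (C * (INR k * (K + 1) + INR k * (K + 1))) by ring.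
  now apply Hsub.
Qed.

Lemma compression_bound (p q : R) : 1 <= p -> p < q ->
  compression_exponent_le (in_conv N p) (in_conv N q) (conv_dist N p) (conv_dist N q) (p / q).
Proof.
  intros Hp Hpq alpha [Ha [f [L [[Hin [Hom _]] [HL Hlow]]]]].
  apply Rnot_lt_le. intro Hlt.
  destruct (Hom 2) as [B HB].
  destruct (image_spread p q B f Hp ltac:(lra) Hin HB) as [D [HD Hspread]].
  set (s := (alpha / p + / q) / 2).
  assert (Hr : 0 < / q) by (apply Rinv_0_lt_compat; lra).
  assert (Hs : / q < s).
  { assert (/ q < alpha / p); [| unfold s; lra].
    apply Rmult_lt_reg_r with p; [lra |].
    replace (alpha / p * p) with alpha by (field; lra). lra. }
  assert (Hap : 0 < alpha / p) by (apply Rdiv_lt_0_compat; lra).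
  set (delta := (1 - p / (q * alpha)) / 2).
  assert (Hdelta : 0 < delta).
  { assert (p / (q * alpha) < 1); [| unfold delta; lra].
    replace (p / (q * alpha)) with (p / q / alpha) by (field; lra).
    apply Rmult_lt_reg_r with alpha; [assumption |].
    replace (p / q / alpha * alpha) with (p / q) by (field; lra). lra. }
  assert (Hds : (1 - delta) * (alpha / p) = s) by (unfold delta, s; field; lra).
  destruct (w_slow delta Hdelta) as [c [Hc Hw]].
  assert (HA : 0 < / L * pw c (alpha / p)).
  { apply Rmult_lt_0_compat; [now apply Rinv_0_lt_compat | now apply pw_gt0]. }
  destruct (power_growth _ (D + L) s (/ q) HA ltac:(lra) ltac:(lra)) as [k [Hk Hgrow]].
  destruct (Hspread k) as [l [l' [Hl [Hinc [Hinc' Hup]]]]].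
  specialize (Hlow (vec l) (vec l') (vec_in_conv p l) (vec_in_conv p l')).
  rewrite <- Hl in Hinc, Hk.
  assert (Hsep := vec_separated p l l' ltac:(lra) Hk Hinc Hinc').
  rewrite Hl in Hsep, Hk. clear Hinc Hinc'.
  assert (Hk1 : 1 <= INR k) by (apply (le_INR 1); assumption).
  rewrite pw_pos in Hup by lra.
  unfold conv_dist at 2, conv_norm in Hlow.
  set (v := compl_norm N _) in *.
  assert (Hv : c * Rpower (INR k) (1 - delta) <= v).
  { apply Rle_trans with (2 := Hsep).
    replace (1 - delta) with (- delta + 1) by ring.
    rewrite Rpower_plus, Rpower_1, <- Rmult_assoc by lra.
    apply Rmult_le_compat_r; [lra |]. now apply Hw. }
  assert (Hpos : 0 < Rpower (INR k) (1 - delta)) by apply exp_pos.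
  assert (Hv0 : 0 <= v) by nra.
  rewrite pw_pw in Hlow by assumption.
  replace (/ p * alpha) with (alpha / p) in Hlow by (field; lra).
  assert (Hv' : pw c (alpha / p) * Rpower (INR k) s <= pw v (alpha / p)).
  { rewrite <- Hds, <- Rpower_mult, <- (pw_pos (Rpower (INR k) (1 - delta))) by assumption.
    rewrite <- pw_mult by lra. apply pw_le; [assumption | nra | assumption]. }
  assert (H1 : 1 <= Rpower (INR k) (/ q)).
  { apply Rle_trans with (Rpower (INR k) 0); [rewrite Rpower_O; lra |].
    apply Rle_Rpower; lra. }
  assert (Hi : 0 < / L) by now apply Rinv_0_lt_compat.
  assert (H2 := Rmult_le_compat_l (/ L) _ _ ltac:(lra) Hv').
  rewrite <- Rmult_assoc in H2. nra.
Qed.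

Lemma no_coarse_lipschitz (p q : R) : 1 <= p -> p < q ->
  ~ exists f, coarse_lipschitz_embedding (in_conv N p) (in_conv N q)
                (conv_dist N p) (conv_dist N q) f.
Proof.
  intros Hp Hpq [f [Hin [L [HL Hf]]]].
  assert (H : 1 <= p / q).
  { apply (compression_bound p q Hp Hpq). split; [lra |]. exists f, L.
    split; [split; [assumption | split] | split; [assumption |]].
    - intro t. exists (L * Rmax t 0 + L). intros x y Hx Hy Hd.
      apply (Hf (Rmax t 0) (Rle_ge _ _ (Rmax_r t 0))); try assumption.
      apply Rle_trans with (1 := Hd), Rmax_l.
    - intro M. exists (Rmax 0 (L * (M + L))). intros t Ht x y Hx Hy Hd.
      assert (P1 := Rmax_l 0 (L * (M + L))). assert (P2 := Rmax_r 0 (L * (M + L))).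
      apply Rge_trans with (/ L * t - L); [apply (Hf t ltac:(lra)); assumption |].
      assert (/ L * (L * (M + L)) <= / L * t); [| rewrite <- Rmult_assoc, Rinv_l in H by lra; lra].
      apply Rmult_le_compat_l; [left; now apply Rinv_0_lt_compat | lra].
    - intros x y Hx Hy. rewrite pw_exp1 by apply pw_nonneg.
      apply (Hf (conv_dist N p x y)); [apply Rle_ge, pw_nonneg | assumption | assumption | lra]. }
  assert (P : p / q * q = p) by (field; lra). nra.
Qed.

End AdmissibleNorm.

Lemma T_weight_slow (delta : R) : 0 < delta -> exists c, 0 < c /\
  forall k, (1 <= k)%nat -> c * Rpower (INR k) (- delta) <= T_weight k.
Proof.
  intro Hd. exists (/ 2). split; [lra |]. intros k Hk. unfold T_weight.
  assert (Hk1 : 1 <= INR k) by (apply (le_INR 1); assumption).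
  assert (Rpower (INR k) (- delta) <= Rpower (INR k) 0) by (apply Rle_Rpower; lra).
  rewrite Rpower_O in H by lra. lra.
Qed.

Lemma S_weight_range (k : nat) : (1 <= k)%nat -> 0 < S_weight k <= 1.
Proof.
  intro Hk. assert (Hk1 : 1 <= INR k) by (apply (le_INR 1); assumption).
  assert (H2 : 0 < ln 2) by (assert (P := ln_lt_2); lra).
  assert (H3 : ln 2 <= ln (INR k + 1)) by (apply ln_le; lra).
  unfold S_weight. split.
  - apply Rinv_0_lt_compat, Rdiv_lt_0_compat; lra.
  - rewrite Rinv_div. apply Rmult_le_reg_r with (ln (INR k + 1)); [lra |].
    replace (ln 2 / ln (INR k + 1) * ln (INR k + 1)) with (ln 2) by (field; lra). lra.
Qed.

Lemma S_weight_slow (delta : R) : 0 < delta -> exists c, 0 < c /\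
  forall k, (1 <= k)%nat -> c * Rpower (INR k) (- delta) <= S_weight k.
Proof.
  intro Hd.
  assert (H2 : 0 < ln 2) by (assert (P := ln_lt_2); lra).
  assert (Hi : 0 < / delta) by now apply Rinv_0_lt_compat.
  exists (ln 2 / (ln 2 + / delta)). split; [apply Rdiv_lt_0_compat; lra |].
  intros k Hk. assert (Hk1 : 1 <= INR k) by (apply (le_INR 1); assumption).
  assert (H3 : ln 2 <= ln (INR k + 1)) by (apply ln_le; lra).
  set (t := Rpower (INR k) delta).
  assert (Ht : 1 + delta * ln (INR k) <= t) by apply exp_ineq1_le.
  assert (Hln : 0 <= ln (INR k)) by (rewrite <- ln_1; apply ln_le; lra).
  assert (Ht1 : 1 <= t) by nra.
  assert (H4 : ln (INR k + 1) <= ln 2 + ln (INR k)).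
  { rewrite <- ln_mult by lra. apply ln_le; lra. }
  assert (H5 : ln (INR k) <= / delta * t).
  { apply Rmult_le_reg_l with delta; [assumption |].
    rewrite <- Rmult_assoc, Rinv_r by lra. lra. }
  assert (H6 : ln (INR k + 1) <= (ln 2 + / delta) * t) by nra.
  rewrite Rpower_Ropp. fold t. unfold S_weight.
  replace (/ (ln (INR k + 1) / ln 2)) with (ln 2 * / ln (INR k + 1)) by (field; lra).
  replace (ln 2 / (ln 2 + / delta) * / t) with (ln 2 * / ((ln 2 + / delta) * t))
    by (field; repeat split; nra).
  apply Rmult_le_compat_l; [lra |]. apply Rinv_le_contravar; lra.
Qed.

Theorem theorem1p2 (p q : R) (hp : 1 <= p) (hpq : p < q) :
  compression_exponent_le (in_conv T_norm p) (in_conv T_norm q)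
    (conv_dist T_norm p) (conv_dist T_norm q) (p / q) /\
  compression_exponent_le (in_conv S_norm p) (in_conv S_norm q)
    (conv_dist S_norm p) (conv_dist S_norm q) (p / q) /\
  ~ (exists f, coarse_lipschitz_embedding (in_conv T_norm p) (in_conv T_norm q)
       (conv_dist T_norm p) (conv_dist T_norm q) f) /\
  ~ (exists f, coarse_lipschitz_embedding (in_conv S_norm p) (in_conv S_norm q)
       (conv_dist S_norm p) (conv_dist S_norm q) f).
Proof.
  assert (HT : forall k Es, T_admissible k Es -> successive k Es) by (intros k Es H; apply H).
  assert (HT' : forall k Es, successive k Es ->
    (forall a, In a (Es 0%nat) -> (k <= S a)%nat) -> T_admissible k Es) by now split.
  assert (HTw : forall k, (1 <= k)%nat -> 0 < T_weight k <= 1)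
    by (intros; unfold T_weight; lra).
  repeat split.
  - now apply (compression_bound _ _ HT HTw HT' T_weight_slow).
  - apply (compression_bound S_admissible S_weight); auto using S_weight_range, S_weight_slow.
  - now apply (no_coarse_lipschitz _ _ HT HTw HT' T_weight_slow).
  - apply (no_coarse_lipschitz S_admissible S_weight); auto using S_weight_range, S_weight_slow.
Qed.
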